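(* Let $\alpha$ be a Pisot number of degree at most $4$, and suppose $\alpha$ is not a root of any of the polynomials $x^2-x-1$, $x^3-x-1$, $x^4-x^3-1$, $x^3-2x^2-x+1$. Then $L(\alpha)\ge \frac13$.
   Context: A Pisot number is a real algebraic integer $\alpha>1$ all of whose other conjugates lie strictly inside the unit disc. For real $x$, $\|x\|$ denotes the distance from $x$ to the nearest integer. For a Pisot number $\alpha$, $L(\alpha):=\sup_{\xi\in\mathbb R}\liminf_{n\to\infty}\|\xi\alpha^n\|$. *)

(* Defs.v *)
From HB Require Import structures.
From mathcomp Require Import all_boot all_order all_algebra.
From mathcomp Require Import all_classical all_reals all_analysis.
From mathcomp Require Import complex.

Set Implicit Arguments.
Unset Strict Implicit.
Unset Printing Implicit Defensive.

Import Order.TTheory GRing.Theory Num.Theory.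
Import numFieldNormedType.Exports.

Local Open Scope classical_set_scope.
Local Open Scope complex_scope.
Local Open Scope ring_scope.

Section PisotNumbers.
Variable R : realType.
Implicit Types (a x : R) (z : R[i]) (p : {poly rat}).

Definition is_min_poly a p : Prop :=
  [/\ p \is monic, irreducible_poly p & root (map_poly ratr p) a].

Definition has_degree a (d : nat) : Prop :=
  exists2 p, is_min_poly a p & size p = d.+1.

Definition conjugate_of a z : Prop :=
  exists2 p, is_min_poly a p & root (map_poly ratr p) z.

(* The norm of [R[i]] takes its values in [R[i]]; the order of [R[i]] extends
   that of [R], so [`|z| < 1] says that [z] is in the open unit disc. *)
Definition pisot a : Prop :=
  [/\ 1 < a,
      integralOver (intr : int -> R) a
    & forall z, conjugate_of a z -> z != a%:C -> `|z| < 1].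

Definition dist_int x : R := inf (range (fun m : int => `|x - m%:~R|)).

(* [dist_int] takes its values in [0, 1/2], so the real-valued [sup] and
   [limn_inf] never fall back on their default values. *)
Definition pisot_L a : R :=
  sup (range (fun xi : R => limn_inf (fun n => dist_int (xi * a ^+ n)))).

End PisotNumbers.

(* Main.v *)
Require Import Defs.
From mathcomp Require Import all_boot all_order all_algebra.
From mathcomp Require Import all_classical all_reals all_analysis.
From mathcomp Require Import complex polyrcf.
From mathcomp Require Import ring lra zify.

Set Implicit Arguments.
Unset Strict Implicit.
Unset Printing Implicit Defensive.

Import Order.TTheory GRing.Theory Num.Theory.
Import numFieldNormedType.Exports.
Local Open Scope classical_set_scope.
Local Open Scope ring_scope.

(** Let P be the integral minimal polynomial of alpha and let (x_n) be a real
sequence with sum_i P_i x_(n+i) an integer for all n.  Subtracting integers from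
the x_n gives a solution X_n of the linear recurrence with characteristic
polynomial P, and X_n - xi alpha^n -> 0 for some xi, because all other roots of P
lie in the open unit disc; hence L(alpha) >= inf_n ||x_n||.  Three families of
such sequences stay in [1/3, 2/3] modulo 1: x_n = t if |P(1)| >= 2,
x_n = (-1)^n t if |P(-1)| >= 2, and x_n = Re(w i^n) with w in P(i)^-1 Z[i] if
P(i) = A + B i with 3(|A| + |B|) <= A^2 + B^2.  As P(1) < 0 < (-1)^d P(-1), when
the first two fail we have P(1) = -1 and P(-1) = (-1)^d, which for d <= 4 leaves
at most two free coefficients; only finitely many such P violate the third
condition, and each of them is either excluded or not the minimal polynomial of
a Pisot number. *)

(** * Distance to the nearest integer and lower bounds for limits inferior *)

Section DistanceToIntegers.
Variable R : realType.
Implicit Types (x y c : R) (u : R^o^nat).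

Lemma dist_int_ge x c :
  (forall m : int, c <= `|x - m%:~R|) -> c <= dist_int x.
Proof.
move=> xc; apply: lb_le_inf; first by exists `|x - 0%:~R|; exists 0.
by move=> _ [m _ <-].
Qed.

Lemma dist_int_le x (m : int) : dist_int x <= `|x - m%:~R|.
Proof.
by apply: ge_inf; [exists 0 => _ [k _ <-]; exact: normr_ge0 | exists m].
Qed.

Lemma dist_int_ge0 x : 0 <= dist_int x.
Proof. by apply: dist_int_ge => m; exact: normr_ge0. Qed.

Lemma dist_int_le1 x : dist_int x <= 1.
Proof.
apply: le_trans (dist_int_le x (Num.floor x)) _.
have := floor_itv x; rewrite intrD => /andP[fx xf].
by rewrite ger0_norm; lra.
Qed.

(** The distance to the integers is 1-periodic and 1-Lipschitz. *)
Lemma dist_int_near x y (m : int) :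
  dist_int x - `|y - x - m%:~R| <= dist_int y.
Proof.
apply: dist_int_ge => k; rewrite lerBlDr.
apply: le_trans (dist_int_le x (k - m)) _.
have -> : x - (k - m)%:~R = y - k%:~R - (y - x - m%:~R).
  by rewrite rmorphB /=; ring.
exact: ler_normB.
Qed.

Lemma dist_int_middle x : 1 / 3 <= x <= 2 / 3 -> 1 / 3 <= dist_int x.
Proof.
move=> /andP[x1 x2]; apply: dist_int_ge => m.
have [m0|m1] := leP m 0.
  have : (m%:~R : R) <= 0 by rewrite lerz0.
  by move=> m0'; rewrite ger0_norm; lra.
have : 1 <= (m%:~R : R) by rewrite ler1z; lia.
by move=> m1'; rewrite ler0_norm; lra.
Qed.

Lemma dist_intN x : dist_int (- x) = dist_int x.
Proof.
suff le y : dist_int y <= dist_int (- y).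
  by apply/eqP; rewrite eq_le le -{2}[x]opprK le.
apply: dist_int_ge => m; apply: le_trans (dist_int_le y (- m)) _.
by rewrite -normrN rmorphN opprD opprK.
Qed.

Lemma bounded_fun01 u : (forall n, 0 <= u n <= 1) -> bounded_fun u.
Proof.
move=> u01; exists 1; split; first exact: num_real.
move=> M M1 n _ /=; have /andP[u0 u1] := u01 n.
by rewrite ger0_norm // (le_trans u1) // ltW.
Qed.

(** This bounds the set in [pisot_L] from above, so that its [sup] is a true supremum. *)
Lemma limn_inf_le1 u : (forall n, 0 <= u n <= 1) -> limn_inf u <= 1.
Proof.
move=> u01; rewrite limn_infE; last exact: bounded_fun01.
apply: ge_sup; first by exists (infs u 0%N); exists 0%N.
move=> _ [n _ <-]; have /andP[_] := u01 n; apply: le_trans.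
apply: ge_inf; last by exists n => /=.
by exists 0 => _ [k _ <-]; have /andP[] := u01 k.
Qed.

Lemma limn_inf_ge u c : (forall n, 0 <= u n <= 1) ->
  (forall e, 0 < e -> \forall n \near \oo, c - e <= u n) -> c <= limn_inf u.
Proof.
move=> u01 uc; have bu := bounded_fun01 u01; rewrite limn_infE //.
apply/ler_addgt0Pr => e e0; have [N _ uN] := uc _ e0.
rewrite -lerBlDr; apply: (@le_trans _ _ (infs u N)).
  apply: lb_le_inf; first by exists (u N); exists N => /=.
  by move=> _ [n /= Nn <-]; exact: uN.
by apply: ub_le_sup; [exact: bounded_fun_has_ubound_infs | exists N].
Qed.

(** Modulo 1 the orbit of [xi] approaches [x] geometrically, so the limit inferior loses nothing. *)
Lemma pisot_L_ge (a c xi C r : R) (x : nat -> R) :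
  0 <= r < 1 -> (forall n, c <= dist_int (x n)) ->
  (forall n, exists m : int, `|xi * a ^+ n - x n - m%:~R| <= C * r ^+ n) ->
  c <= pisot_L a.
Proof.
move=> /andP[r0 r1] xc xim.
have b01 z n : 0 <= dist_int (z * a ^+ n) <= 1.
  by rewrite dist_int_ge0 dist_int_le1.
apply: (@le_trans _ _ (limn_inf (fun n => dist_int (xi * a ^+ n)))); last first.
  apply: ub_le_sup; last by exists xi.
  by exists 1 => _ [z _ <-]; apply: limn_inf_le1.
apply: limn_inf_ge => // e e0.
have : geometric C r n @[n --> \oo] --> (0 : R).
  by apply: cvg_geometric; rewrite ger0_norm.
move=> /cvgrPdist_lt /(_ e e0); apply: filterS => n.
rewrite /geometric /= sub0r normrN => geo_lt.
have [m xm] := xim n; apply: le_trans (dist_int_near (x n) _ m).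
have := le_lt_trans (le_trans xm (ler_norm _)) geo_lt.
by have := xc n; lra.
Qed.

End DistanceToIntegers.

(** * Polynomials in the shift operator and integral linear recurrences *)

Section ShiftEvaluation.
Variable K : comNzRingType.
Implicit Types (p q : {poly K}) (X Y : nat -> K) (a c z : K) (n N : nat).

(** This is the [n]-th term of p(S) X, where S is the shift X_n -> X_(n+1). *)
Definition shift_eval p X n : K := \sum_(i < size p) p`_i * X (n + i)%N.

Lemma shift_eval_widen p X n N : (size p <= N)%N ->
  shift_eval p X n = \sum_(i < N) p`_i * X (n + i)%N.
Proof.
move=> pN; rewrite /shift_eval (big_ord_widen N (fun i => p`_i * X (n + i)%N)) //.
rewrite big_mkcond; apply: eq_bigr => i _ /=; case: ltnP => // pi.
by rewrite nth_default // mul0r.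
Qed.

Lemma shift_eval1 X n : shift_eval 1 X n = X n.
Proof. by rewrite /shift_eval size_poly1 big_ord1 coef1 mul1r addn0. Qed.

Lemma shift_evalB p X Y n :
  shift_eval p (fun k => X k - Y k) n = shift_eval p X n - shift_eval p Y n.
Proof. by rewrite /shift_eval -sumrB; apply: eq_bigr => i _; rewrite mulrBr. Qed.

(** Geometric sequences are eigenvectors of the shift. *)
Lemma shift_eval_geom p c a n :
  shift_eval p (fun k => c * a ^+ k) n = c * a ^+ n * p.[a].
Proof.
rewrite /shift_eval horner_coef mulr_sumr; apply: eq_bigr => i _.
by rewrite exprD; ring.
Qed.

Lemma shift_eval_XsubC z q X n :
  shift_eval (('X - z%:P) * q) X n =
  shift_eval q X n.+1 - z * shift_eval q X n.
Proof.
rewrite (@shift_eval_widen _ X n (size q).+1); last first.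
  by apply: leq_trans (size_polyMleq _ _) _; rewrite size_XsubC.
rewrite (@shift_eval_widen q X n (size q).+1) //.
under eq_bigr => i _ do rewrite mulrBl coefB coefXM coefCM mulrBl.
rewrite sumrB mulr_sumr; congr (_ - _); last first.
  by apply: eq_bigr => i _; rewrite mulrA.
rewrite big_ord_recl /= mul0r add0r; apply: eq_bigr => i _ /=.
by rewrite /bump /= add1n addSnnS.
Qed.

End ShiftEvaluation.

Lemma shift_eval_map (K L : comNzRingType) (f : {rmorphism K -> L})
    (p : {poly K}) (X : nat -> K) n :
  shift_eval (map_poly f p) (f \o X) n = f (shift_eval p X n).
Proof.
rewrite (@shift_eval_widen _ _ _ _ (size p)) ?size_poly // /shift_eval.
by rewrite rmorph_sum; apply: eq_bigr => i _; rewrite rmorphM /= coef_map.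
Qed.

(* Course-of-values recursion: [f] receives the list of the previous values. *)
Lemma seq_recursion (T : Type) (f : seq T -> T) :
  exists g : nat -> T, forall n, g n = f (mkseq g n).
Proof.
pose h := fix h n := if n is n'.+1 then rcons (h n') (f (h n')) else [::].
exists (fun n => f (h n)) => n; congr f.
by elim: n => // n IHn; rewrite mkseqS -IHn.
Qed.

(** As [P] is monic, each new term is found without division and stays an integer. *)
Lemma int_recurrence_solvable (P : {poly int}) (k : nat -> int) :
  P \is monic -> exists m : nat -> int, forall n, shift_eval P m n = k n.
Proof.
move=> Pmon; pose d := (size P).-1.
have sP : size P = d.+1 by rewrite prednK // size_poly_gt0 monic_neq0.
(* The first [d] terms are free and set to 0; the equation at [n] fixes the term of index
   [n + d]. *)
pose f (s : seq int) := if (size s < d)%N then 0 else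
  k (size s - d)%N - \sum_(i < d) P`_i * nth 0 s (size s - d + i)%N.
have [m mE] := seq_recursion f; exists m => n.
rewrite /shift_eval sP big_ord_recr /= (mE (n + d)%N) /f size_mkseq.
rewrite ltnNge leq_addl /= addnK.
have -> : P`_d = 1 by rewrite -(monicP Pmon) lead_coefE.
rewrite mul1r [X in _ - X](eq_bigr (fun i : 'I_d => P`_i * m (n + i)%N)); last first.
  by move=> i _; rewrite nth_mkseq // ltn_add2l.
by rewrite addrC subrK.
Qed.

(** * Geometric decay of solutions of linear recurrences *)

Section Decay.
Variable C : numFieldType.
Implicit Types (z r D : C) (V X : nat -> C) (s : seq C).

(** The bound [D' * r ^+ n] reproduces itself by induction once D <= D' (r - |z|). *)
Lemma geometric_decay_step z V r D : `|z| < r ->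
  (forall n, `|V n.+1 - z * V n| <= D * r ^+ n) ->
  exists D', forall n, `|V n| <= D' * r ^+ n.
Proof.
move=> zr VD; have rz : 0 < r - `|z| by rewrite subr_gt0.
have r0 : 0 <= r by rewrite ltW // (le_lt_trans _ zr).
have D0 : 0 <= D by have := VD 0%N; rewrite expr0 mulr1; apply: le_trans.
pose D' := `|V 0%N| + D / (r - `|z|).
exists D'; elim=> [|n IHn].
  by rewrite expr0 mulr1 lerDl divr_ge0 // ltW.
have DD' : D <= D' * (r - `|z|).
  by rewrite mulrDl divfK ?gt_eqF // lerDr mulr_ge0 // ltW.
rewrite -[V n.+1](subrK (z * V n)); apply: le_trans (ler_normD _ _) _.
rewrite normrM; apply: le_trans (lerD (VD n) (ler_wpM2l _ IHn)) _ => //.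
have -> : D' * r ^+ n.+1 = D' * (r - `|z|) * r ^+ n + `|z| * (D' * r ^+ n).
  by rewrite exprS; ring.
by rewrite lerD2r ler_wpM2r // exprn_ge0.
Qed.

(** Linear factors are peeled off one by one at the same rate [r]. As [r] strictly exceeds every
    |z|, multiple roots need no separate treatment. *)
Lemma geometric_decay s X r D : {in s, forall z, `|z| < r} ->
  (forall n, `|shift_eval (\prod_(z <- s) ('X - z%:P)) X n| <= D * r ^+ n) ->
  exists D', forall n, `|X n| <= D' * r ^+ n.
Proof.
elim: s D => [|z s IHs] D sr XD.
  by exists D => n; have := XD n; rewrite big_nil shift_eval1.
have [|D' XD'] := @geometric_decay_step z
  (shift_eval (\prod_(z <- s) ('X - z%:P)) X) r D (sr z (mem_head _ _)).
  by move=> n; have := XD n; rewrite big_cons shift_eval_XsubC.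
by apply: IHs XD' => y ys; apply: sr; rewrite inE ys orbT.
Qed.

End Decay.

(** * Dominant roots, and orbits that [P] maps to integers *)

Section DominantRoot.
Variable R : realType.
Implicit Types (a c : R) (P : {poly int}) (Q : {poly R}).

Definition roots_in_disc Q : Prop :=
  forall z : R[i], root (map_poly (real_complex R) Q) z -> `|z| < 1.

(** Since Q(a) = P'(a), the condition [Q.[a] != 0] says that the root [a] is simple. *)
Definition dominant_root a P Q : Prop :=
  [/\ P \is monic, map_poly intr P = ('X - a%:P) * Q, Q.[a] != 0
    & roots_in_disc Q].

Lemma disc_radius (s : seq R[i]) : {in s, forall z, `|z| < 1} ->
  exists2 r : R, 0 <= r < 1 & {in s, forall z, `|z| < (r%:C)%C}.
Proof.
elim: s => [|z s IHs] s1; first by exists 0; rewrite ?lexx ?ltr01.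
have [|r /andP[r0 r1] sr] := IHs.
  by move=> y ys; apply: s1; rewrite inE ys orbT.
have := s1 z (mem_head _ _); rewrite normc_def -[1]/(1%:C)%C ltcR.
set t := Num.sqrt _ => t1.
(* This is below 1 and strictly above both [r] and [t]. *)
exists (1 - (1 - r) * (1 - t) / 2).
  have t0 : 0 <= t := sqrtr_ge0 _.
  by apply/andP; split; nra.
have t0 : 0 <= t := sqrtr_ge0 _.
move=> y; rewrite inE => /orP[/eqP ->|/sr yr].
  by rewrite normc_def ltcR -/t; nra.
by apply: lt_le_trans yr _; rewrite lecR; nra.
Qed.

Lemma shift_eval0_decay Q (W : nat -> R) : roots_in_disc Q -> Q \is monic ->
  (forall n, shift_eval Q W n = 0) ->
  exists2 r : R, 0 <= r < 1 & exists D : R, forall n, `|W n| <= D * r ^+ n.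
Proof.
move=> Qdisc Qmon QW; pose QC := map_poly (real_complex R) Q.
have [s QCs] := closed_field_poly_normal QC.
have {}QCs : QC = \prod_(z <- s) ('X - z%:P).
  by rewrite QCs (monicP (monic_map _ Qmon)) scale1r.
have [|r r01 sr] := @disc_radius s.
  by move=> z zs; apply: Qdisc; rewrite -/QC QCs root_prod_XsubC.
exists r => //.
have [n|D WD] := @geometric_decay _ s (real_complex R \o W) (r%:C)%C 0 sr.
  by rewrite -QCs shift_eval_map QW rmorph0 normr0 mul0r.
(* The constant [D] is complex, but an inequality in [R[i]] entails the one between real parts. *)
exists (complex.Re D) => n; have := WD n.
rewrite -rmorphXn /= normc_def /= expr0n addr0 sqrtr_sqr.
by case: D {WD} => u v; rewrite lecE /= !mulr0 subr0 => /andP[].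
Qed.

(** With P(S) = (S - a) Q(S), the difference X = x - m is killed by P(S), so Q(S) X is geometric of
    ratio [a]. *)
Lemma pisot_L_ge_orbit a P Q c (x : nat -> R) : dominant_root a P Q ->
  (forall n, exists m : int, shift_eval (map_poly intr P) x n = m%:~R) ->
  (forall n, c <= dist_int (x n)) -> c <= pisot_L a.
Proof.
move=> [Pmon PQ Qa0 Qdisc] /choice[k xk] xc.
have Qmon : Q \is monic.
  by rewrite -(monicMl _ (monicXsubC a)) -PQ monic_map.
have [m mk] := int_recurrence_solvable k Pmon.
pose X n := x n - (m n)%:~R.
have QX n : shift_eval Q X n.+1 = a * shift_eval Q X n.
  apply/eqP; rewrite -subr_eq0 -shift_eval_XsubC -PQ shift_evalB xk.
  by rewrite (shift_eval_map intr P m) mk subrr.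
have {}QX n : shift_eval Q X n = shift_eval Q X 0 * a ^+ n.
  by elim: n => [|n IHn]; rewrite ?mulr1 // QX IHn exprS mulrCA.
(* With this value Q(S) kills X_n - xi a^n, which therefore decays. *)
pose xi := shift_eval Q X 0 / Q.[a].
have [n|r r01 [D XD]] := @shift_eval0_decay Q (fun n => X n - xi * a ^+ n) Qdisc Qmon.
  by rewrite shift_evalB shift_eval_geom QX mulrAC divfK // subrr.
apply: (@pisot_L_ge _ a c xi D r x) => // n.
exists (- m n); apply: le_trans (XD n); rewrite -normrN le_eqVlt.
by apply/orP; left; apply/eqP; congr `|_|; rewrite /X rmorphN /=; ring.
Qed.

End DominantRoot.

(** * Periodic orbits staying in the middle third modulo 1 *)

Section PeriodicOrbits.
Variable R : realType.
Implicit Types (a : R) (P : {poly int}) (Q : {poly R}).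

(* The orbit [n |-> t * e ^ n], where [t] is the multiple of [1 / P(e)] just
   below [1 / 2]. *)
Lemma pisot_L_ge_third_sign a P Q (e : int) : dominant_root a P Q ->
  (e == 1) || (e == -1) -> 2 <= `|P.[e]| -> 1 / 3 <= pisot_L a.
Proof.
move=> dom e1 Pe2; pose N := `|P.[e]|%N; pose h := (N %/ 2)%N.
have N2 : (2 <= N)%N by rewrite /N; lia.
have N0 : (0 : R) < N%:R by rewrite ltr0n; lia.
pose t : R := h%:R / N%:R.
(* For N >= 2 the worst case is N = 3, where t = 1/3. *)
have t_mid : 1 / 3 <= t <= 2 / 3.
  have h1 : (N%:R : R) <= 3 * h%:R by rewrite -natrM ler_nat /h; lia.
  have h2 : 2 * (h%:R : R) <= N%:R by rewrite -natrM ler_nat /h; lia.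
  by rewrite /t ler_pdivlMr // ler_pdivrMr //; lra.
apply: (pisot_L_ge_orbit dom (x := fun n => t * e%:~R ^+ n)) => n.
  exists (h%:Z * e ^+ n * sgz P.[e]).
  rewrite shift_eval_geom horner_map /= {1}[P.[e]]intEsg -/N.
  rewrite /t !rmorphM /= rmorphXn /=; field.
  exact: lt0r_neq0.
suff [->|->] : (e%:~R ^+ n : R) = 1 \/ (e%:~R ^+ n : R) = -1.
- by rewrite mulr1; exact: dist_int_middle.
- by rewrite mulrN1 dist_intN; exact: dist_int_middle.
case/orP: e1 => /eqP ->; first by left; rewrite expr1n.
by rewrite rmorphN -signr_odd; case: odd; [right | left].
Qed.

(* The orbit [n |-> Re (w * i ^ n)] with [w = g / P(i)], where [g] is a Gaussian
   integer nearest to [P(i) * (1 + i) / 2]: [Re w] and [Im w] are within [1 / 6]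
   of [1 / 2], and the orbit only takes the values [± Re w] and [± Im w]. *)
Lemma pisot_L_ge_third_imaginary a P Q (A B : int) : dominant_root a P Q ->
  (map_poly intr P).['i%C] = (A%:~R +i* B%:~R)%C :> R[i] ->
  0 < A ^+ 2 + B ^+ 2 -> 3 * (`|A| + `|B|) <= A ^+ 2 + B ^+ 2 ->
  1 / 3 <= pisot_L a.
Proof.
move=> dom Pi N0 NAB; pose N := A ^+ 2 + B ^+ 2.
pose g1 := ((A - B + 1) %/ 2)%Z; pose g2 := ((A + B + 1) %/ 2)%Z.
pose g : R[i] := (g1%:~R +i* g2%:~R)%C.
pose u : R := (g1 * A + g2 * B)%:~R / N%:~R.
pose v : R := (g2 * A - g1 * B)%:~R / N%:~R.
pose w : R[i] := (u +i* v)%C.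
have NR0 : (0 : R) < N%:~R by rewrite ltr0z.
(* A - B and A + B have the same parity, so one rounding error serves both. *)
have [e e01 [g1E g2E]] : exists2 e : int, e = 0 \/ e = 1 &
    2 * g1 = A - B + e /\ 2 * g2 = A + B + e.
  by exists (2 * g1 - (A - B)); rewrite /g1 /g2; lia.
(* The numerator of [u] differs from N/2 by e(A + B)/2, at most N/6 by [NAB]; likewise for [v]. *)
have uE : 2 * (g1 * A + g2 * B) = N + e * (A + B).
  by rewrite mulrDr !mulrA g1E g2E /N; ring.
have vE : 2 * (g2 * A - g1 * B) = N + e * (A - B).
  by rewrite mulrBr !mulrA g1E g2E /N; ring.
rewrite -/N in NAB.
have mid (k : int) : N <= 3 * k <= 2 * N ->
    1 / 3 <= (k%:~R / N%:~R : R) <= 2 / 3.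
  move=> /andP[k1 k2].
  have k1R : N%:~R <= 3 * (k%:~R : R) by rewrite -[3]/(3%:~R) -intrM ler_int.
  have k2R : 3 * (k%:~R : R) <= 2 * N%:~R.
    by rewrite -[3]/(3%:~R) -[2]/(2%:~R) -!intrM ler_int.
  by rewrite ler_pdivlMr // ler_pdivrMr //; lra.
have u_mid : 1 / 3 <= u <= 2 / 3.
  by apply: mid; move: uE NAB; clearbody N; case: e01 => ->; lia.
have v_mid : 1 / 3 <= v <= 2 / 3.
  by apply: mid; move: vE NAB; clearbody N; case: e01 => ->; lia.
have wP : w * (map_poly intr P).['i%C] = g.
  rewrite Pi /w /g; apply/eqP; rewrite eq_complex /=.
  have NE : N%:~R = A%:~R ^+ 2 + B%:~R ^+ 2 :> R.
    by rewrite /N rmorphD !rmorphXn.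
  have NE0 : A%:~R ^+ 2 + B%:~R ^+ 2 != 0 :> R by rewrite -NE lt0r_neq0.
  by rewrite /u /v NE !(rmorphB, rmorphD, rmorphM) /=; apply/andP; split;
    apply/eqP; field.
have gauss n : exists c d : int, 'i%C ^+ n * g = (c%:~R +i* d%:~R)%C.
  elim: n => [|n [c [d IHn]]]; first by exists g1, g2; rewrite mul1r.
  exists (- d), c; rewrite exprS -mulrA IHn; apply/eqP.
  by rewrite eq_complex /= !mul0r !mul1r !add0r rmorphN /= !eqxx.
apply: (pisot_L_ge_orbit dom (x := fun n => complex.Re (w * 'i%C ^+ n))) => n.
  have [c [d cd]] := gauss n; exists c.
  (* As [P] has real coefficients, taking real parts commutes with P(S). *)
  have -> : c%:~R = complex.Re (shift_eval (map_poly intr P)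
      (fun k => w * 'i%C ^+ k) n) :> R.
    by rewrite shift_eval_geom mulrAC wP mulrC cd.
  rewrite !(@shift_eval_widen _ _ _ _ (size P)) ?size_poly //.
  rewrite (big_morph (@complex.Re R) (id1 := 0) (op1 := +%R)) //; last by case=> ? ? [].
  apply: eq_bigr => i _; rewrite !coef_map /=.
  have -> : (P`_i)%:~R = (((P`_i)%:~R : R)%:C)%C :> R[i] by rewrite rmorph_int.
  by case: (w * _) => p q /=; rewrite mul0r subr0.
suff : 1 / 3 <= dist_int (complex.Re (w * 'i%C ^+ n)) /\
       1 / 3 <= dist_int (complex.Im (w * 'i%C ^+ n)) by case.
elim: n => [|n [IHr IHi]].
  by rewrite mulr1; split; exact: dist_int_middle.
by rewrite exprSr mulrA ReiNIm ImiRe dist_intN.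
Qed.

End PeriodicOrbits.

(** * From Pisot numbers to dominant roots; signs and size of the cofactor *)

Section PisotPolynomials.
Variable R : realType.
Implicit Types (a x : R) (p : {poly rat}) (P : {poly int}) (Q : {poly R}).

Lemma map_ratr_int (F : numFieldType) P :
  map_poly (ratr : rat -> F) (map_poly intr P) = map_poly intr P.
Proof.
by rewrite -map_poly_comp; apply: eq_map_poly => m /=; rewrite ratr_int.
Qed.

(** Otherwise [p] and [q] are coprime over the rationals, hence over [F], and share no root. *)
Lemma irreducible_root_dvdp (F : numFieldType) (x : F) (p q : {poly rat}) :
  irreducible_poly p -> root (map_poly ratr p) x -> root (map_poly ratr q) x ->
  p %| q.
Proof.
move=> pirr px qx; apply: contraLR qx => /negP pq.
have : coprimep p q by rewrite irreducible_poly_coprime //; exact/negP.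
by rewrite -(coprimep_map (ratr : rat -> F)) => /coprimep_root; apply.
Qed.

(** In characteristic 0 the derivative is nonzero and of smaller degree, so [p] cannot divide it. *)
Lemma irreducible_root_simple (F : numFieldType) (x : F) (p : {poly rat}) :
  irreducible_poly p -> root (map_poly ratr p) x ->
  ~~ root (map_poly ratr p^`()) x.
Proof.
move=> pirr px; apply/negP => /(irreducible_root_dvdp pirr px).
have [sp _] := pirr.
have p'0 : p^`() != 0.
  apply: contraTneq isT => /(congr1 (fun q : {poly rat} => q`_(size p).-2)).
  rewrite coef_deriv coef0.
  have sp1 : (size p).-2.+1 = (size p).-1 by case: (size p) sp => [|[]].
  rewrite sp1 -lead_coefE => /eqP.
  by rewrite mulrn_eq0 lead_coef_eq0 -size_poly_eq0; case: (size p) sp => [|[]].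
move=> /(dvdp_leq p'0); apply/negP; rewrite -ltnNge lt_size_deriv //.
by rewrite -size_poly_gt0 ltnW.
Qed.

(** Gauss's lemma: [p] divides a monic integral polynomial, so its integral multiple [P] has leading
    coefficient 1 or -1. *)
Lemma integral_min_poly a p : integralOver (intr : int -> R) a ->
  is_min_poly a p -> exists2 P, P \is monic & p = map_poly intr P.
Proof.
move=> [q qmon qa] [pmon pirr pa].
have : p %| map_poly intr q.
  by apply: irreducible_root_dvdp pirr pa _; rewrite map_ratr_int.
move=> /dvdpP_rat_int [P [c c0 pP] [r qPr]].
have : lead_coef P * lead_coef r = 1 by rewrite -lead_coefM -qPr (monicP qmon).
move: (monicP pmon); rewrite pP lead_coefZ lead_coef_map_inj //; last exact: intr_inj.
move=> cP; rewrite mulrC => /intUnitRing.unitzPl; rewrite qualifE /= => /orP[] /eqP lP.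
  exists P; first by rewrite monicE lP.
  by move: cP; rewrite lP mulr1 => ->; rewrite scale1r.
exists (- P); first by rewrite monicE lead_coefN lP opprK.
move: cP; rewrite lP mulrN1 => /eqP; rewrite eqr_oppLR => /eqP ->.
by rewrite scaleN1r rmorphN.
Qed.

Lemma pisot_dominant_root a d : pisot a -> has_degree a d ->
  exists P Q, [/\ dominant_root a P Q, size P = d.+1
                & irreducible_poly (map_poly intr P : {poly rat})].
Proof.
move=> [a1 aint aconj] [p pmin sp].
have [P Pmon pP] := integral_min_poly aint pmin.
have [pmon pirr pa] := pmin.
have PR : map_poly ratr p = map_poly intr P :> {poly R} by rewrite pP map_ratr_int.
have PC : map_poly ratr p = map_poly intr P :> {poly R[i]} by rewrite pP map_ratr_int.
have [Q PQ] := factor_theorem _ _ pa.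
rewrite mulrC PR in PQ.
have Qa0 : Q.[a] != 0.
  have := irreducible_root_simple pirr pa.
  rewrite rootE -deriv_map PR PQ derivM derivXsubC !hornerE.
  by rewrite subrr mul0r addr0.
exists P, Q; split; last 2 first.
- by rewrite -sp pP size_map_inj_poly //; exact: intr_inj.
- by rewrite -pP.
split=> // z Qz; apply: aconj.
  exists p => //; rewrite PC.
  have -> : map_poly intr P = map_poly (real_complex R) (map_poly intr P).
    by rewrite -map_poly_comp; apply: eq_map_poly => m /=; rewrite rmorph_int.
  by rewrite PQ rmorphM /= rootM Qz orbT.
(* A root of [Q] is a conjugate other than [a], because Q(a) is nonzero. *)
apply: contraTneq Qz => ->; rewrite rootE horner_map /=.
by rewrite -[0]/((0 : R)%:C)%C (inj_eq (@complexI R)).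
Qed.

Lemma roots_in_disc_real Q x : roots_in_disc Q -> root Q x -> `|x| < 1.
Proof.
move=> Qdisc Qx; have : `|(x%:C)%C : R[i]| < 1.
  by apply: Qdisc; rewrite rootE horner_map /= (rootP Qx).
by rewrite normc_def /= expr0n addr0 sqrtr_sqr -[1]/((1 : R)%:C)%C ltcR.
Qed.

(** No real root lies beyond [x], so the sign at [x] is the sign at infinity. *)
Lemma roots_in_disc_gt0 Q x : roots_in_disc Q -> Q \is monic -> 1 <= x ->
  0 < Q.[x].
Proof.
move=> Qdisc Qmon x1.
have noroot : {in `[x, +oo[, forall y, ~~ root Q y}.
  move=> y; rewrite in_itv /= andbT => xy; apply/negP => /(roots_in_disc_real Qdisc).
  by rewrite ltNge (le_trans (le_trans x1 xy)) // ler_norm.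
have := sgp_pinftyP noroot (_ : x \in `[x, +oo[).
rewrite in_itv /= lexx /= => /(_ isT).
by rewrite /sgp_pinfty (monicP Qmon) sgr1 => /eqP; rewrite sgr_cp0.
Qed.

Lemma roots_in_disc_sign Q x : roots_in_disc Q -> Q \is monic -> x <= -1 ->
  0 < (-1) ^+ (size Q).-1 * Q.[x].
Proof.
move=> Qdisc Qmon x1.
have noroot : {in `]-oo, x], forall y, ~~ root Q y}.
  move=> y; rewrite in_itv /= => yx; apply/negP => /(roots_in_disc_real Qdisc).
  by rewrite ltNge -normrN (le_trans _ (ler_norm _)) // lerNr (le_trans yx).
have := sgp_minftyP noroot (_ : x \in `]-oo, x]).
rewrite in_itv /= lexx /= => /(_ isT).
rewrite /sgp_minfty (monicP Qmon) mulr1 => sgQ.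
by rewrite -sgr_cp0 sgrM sgQ -sgrM -expr2 sqrr_sign sgr1.
Qed.

(** Up to sign, Q(0) is the product of the roots, and there is at least one. *)
Lemma roots_in_disc_const Q : roots_in_disc Q -> Q \is monic ->
  (1 < size Q)%N -> `|Q.[0]| < 1.
Proof.
move=> Qdisc Qmon sQ; pose QC := map_poly (real_complex R) Q.
have [s QCs] := closed_field_poly_normal QC.
have {}QCs : QC = \prod_(z <- s) ('X - z%:P).
  by rewrite QCs (monicP (monic_map _ Qmon)) scale1r.
have s1 z : z \in s -> `|z| < 1.
  by move=> zs; apply: Qdisc; rewrite -/QC QCs root_prod_XsubC.
suff : `|QC.[0]| < 1.
  rewrite -[X in QC.[X]](rmorph0 (real_complex R)) horner_map /=.
  by rewrite normc_def /= expr0n addr0 sqrtr_sqr -[1]/((1 : R)%:C)%C ltcR.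
have : (1 < size QC)%N by rewrite /QC size_map_poly.
rewrite QCs size_prod_XsubC ltnS => s0.
rewrite horner_prod normr_prod.
case: s s0 s1 {QCs} => // z s _ s1.
rewrite big_cons hornerXsubC sub0r normrN.
apply: le_lt_trans (s1 z (mem_head _ _)).
rewrite ler_piMr //.
rewrite big_seq; apply: prodr_ile1 => y ys.
by rewrite normr_ge0 hornerXsubC sub0r normrN ltW // s1 // inE ys orbT.
Qed.

End PisotPolynomials.

(** * Case analysis in degrees 1 to 4 *)

Lemma irreducible_horner0 (F : idomainType) (p : {poly F}) :
  irreducible_poly p -> (2 < size p)%N -> p.[0] != 0.
Proof.
move=> [_ pirr] sp; apply: contraTneq sp => p0.
have /eqp_size <- : 'X %= p.
  by apply: pirr; rewrite ?size_polyX // -['X]subr0 dvdp_XsubCl; exact/rootP.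
by rewrite size_polyX.
Qed.

Lemma horner_monic_intr (K : comNzRingType) (P : {poly int}) (n : nat) (x : K) :
  P \is monic -> size P = n.+1 ->
  (map_poly intr P).[x] = \sum_(i < n) (P`_i)%:~R * x ^+ i + x ^+ n.
Proof.
move=> Pmon sP; rewrite (@horner_coef_wide _ n.+1) -?sP ?size_poly //.
rewrite sP big_ord_recr /= coef_map /=; congr (_ + _).
  by apply: eq_bigr => i _; rewrite coef_map.
by have := monicP Pmon; rewrite lead_coefE sP /= => ->; rewrite mul1r.
Qed.

Lemma horner_monic_int (P : {poly int}) (n : nat) (x : int) :
  P \is monic -> size P = n.+1 -> P.[x] = \sum_(i < n) P`_i * x ^+ i + x ^+ n.
Proof.
move=> Pmon sP; have := horner_monic_intr x Pmon sP.
rewrite map_poly_id; last by move=> y _; rewrite /= intz.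
by move=> ->; congr (_ + _); apply: eq_bigr => i _; rewrite intz.
Qed.

Section SmallDegree.
Variables (R : realType) (a : R) (P : {poly int}) (Q : {poly R}).
Hypotheses (a1 : 1 < a) (dom : dominant_root a P Q).

Let Pmon : P \is monic. Proof. by case: dom. Qed.
Let PQ : map_poly intr P = ('X - a%:P) * Q. Proof. by case: dom. Qed.
Let Qdisc : roots_in_disc Q. Proof. by case: dom. Qed.

Let Qmon : Q \is monic.
Proof. by rewrite -(monicMl _ (monicXsubC a)) -PQ monic_map. Qed.

Lemma dominant_root_size : size P = (size Q).+1.
Proof.
rewrite -(size_map_inj_poly (@intr_inj R) (rmorph0 _)) PQ.
by rewrite size_monicM ?monicXsubC ?monic_neq0 // size_XsubC.
Qed.

Lemma dominant_root_horner (m : int) :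
  (P.[m])%:~R = (m%:~R - a) * Q.[m%:~R].
Proof. by rewrite -horner_map /= PQ !hornerE. Qed.

Lemma dominant_root_eq0 : (map_poly intr P).[a] = 0.
Proof. by rewrite PQ !hornerE subrr mul0r. Qed.

Lemma dominant_root_horner1 : P.[1] < 0.
Proof.
rewrite -(ltrz0 R) dominant_root_horner rmorph1.
by rewrite pmulr_llt0 ?subr_lt0 ?roots_in_disc_gt0.
Qed.

Lemma dominant_root_hornerN1 : 0 < (-1) ^+ (size P).-1 * P.[-1].
Proof.
rewrite -(ltr0z R) rmorphM rmorphXn /= dominant_root_horner rmorphN1.
have := roots_in_disc_sign Qdisc Qmon (lexx (-1)).
have : (0 < size Q)%N by rewrite size_poly_gt0 monic_neq0.
rewrite dominant_root_size /=; case: (size Q) => //= n _ Q1.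
have -> : (-1) ^+ n.+1 * ((-1 - a) * Q.[-1]) = (1 + a) * ((-1) ^+ n * Q.[-1]).
  by rewrite exprS; ring.
by rewrite mulr_gt0 // addr_gt0 ?ltr01 // (lt_trans ltr01).
Qed.

(** Here |P(0)| = a |Q(0)| with |Q(0)| < 1. This later discards polynomials whose constant term is
    too large for their real root. *)
Lemma dominant_root_horner0 : (2 < size P)%N -> `|P`_0|%:~R < a.
Proof.
rewrite dominant_root_size ltnS -horner_coef0 => sQ.
rewrite intr_norm dominant_root_horner rmorph0 sub0r normrM normrN.
rewrite (gtr0_norm (lt_trans ltr01 a1)) gtr_pMr ?(lt_trans ltr01) //.
exact: roots_in_disc_const.
Qed.

Lemma third_le_or_units :
  1 / 3 <= pisot_L a \/ P.[1] = -1 /\ P.[-1] = (-1) ^+ (size P).-1.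
Proof.
have [P1|P1] := leP 2 `|P.[1]|.
  by left; exact: (pisot_L_ge_third_sign dom (e := 1)).
have [PN1|PN1] := leP 2 `|P.[-1]|.
  by left; exact: (pisot_L_ge_third_sign dom (e := -1)).
right; split; first by have := dominant_root_horner1; lia.
have := dominant_root_hornerN1; rewrite -signr_odd.
by case: odd; rewrite ?expr0 ?expr1 /=; lia.
Qed.

Lemma third_le_degree1 : size P = 2%N -> 1 / 3 <= pisot_L a.
Proof.
move=> sP; have [//|] := third_le_or_units.
rewrite !(horner_monic_int _ Pmon sP) sP !big_ord_recr !big_ord0 /=.
(* In degree 1, P(1) - P(-1) = 2, whereas both values would be -1. *)
by move=> [P1 PN1]; exfalso; lia.
Qed.

Lemma third_le_degree2 : size P = 3%N ->
  ~~ root ('X^2 - 'X - 1 : {poly R}) a -> 1 / 3 <= pisot_L a.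
Proof.
move=> sP /negP nr; have [//|] := third_le_or_units.
have := dominant_root_eq0.
rewrite (horner_monic_intr _ Pmon sP) !(horner_monic_int _ Pmon sP) sP.
rewrite !big_ord_recr !big_ord0 /=.
set c0 := P`_0; set c1 := P`_1 => Pa [P1 PN1].
have [c0E c1E] : c0 = -1 /\ c1 = -1 by lia.
case: nr; rewrite rootE !hornerE -Pa c0E c1E; apply/eqP; ring.
Qed.

Lemma third_le_degree3 : size P = 4%N -> P`_0 != 0 ->
  ~~ root ('X^3 - 'X - 1 : {poly R}) a ->
  ~~ root ('X^3 - 2%:R *: 'X^2 - 'X + 1 : {poly R}) a -> 1 / 3 <= pisot_L a.
Proof.
move=> sP P0 /negP nr1 /negP nr2; have [//|] := third_le_or_units.
have := dominant_root_horner0; rewrite sP => /(_ isT).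
have := dominant_root_eq0; rewrite (horner_monic_intr _ Pmon sP).
rewrite !(horner_monic_int _ Pmon sP) !big_ord_recr !big_ord0 /=.
rewrite add0r expr0 mulr1 expr1.
move: P0; set c0 := P`_0; set c1 := P`_1; set c2 := P`_2.
move=> P0 Pa c0a [P1 PN1].
have c1E : c1 = -1 by lia.
have c0E : c0 = -1 - c2 by lia.
have Pi : (map_poly intr P).['i%C] = ((-1 - 2 * c2)%:~R +i* (-2)%:~R)%C :> R[i].
  rewrite (horner_monic_intr _ Pmon sP) !big_ord_recr !big_ord0 /=.
  rewrite -/c0 -/c1 -/c2 c1E c0E -!(rmorph_int (real_complex R)) !exprS expr0.
  by apply/eqP; rewrite eq_complex /=; apply/andP; split; apply/eqP;
    rewrite ?(rmorphB, rmorphM, rmorphN) /=; ring.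
have [N|N] := leP (3 * (`|-1 - 2 * c2| + `|-2|)) ((-1 - 2 * c2) ^+ 2 + (-2) ^+ 2).
  by apply: (pisot_L_ge_third_imaginary dom Pi) => //; nia.
(* In turn: an excluded cubic, a zero constant term, the excluded x^3 - x - 1, and x^3 + x^2 - x -
   2, which is positive beyond 2 while a > |c0| = 2. *)
have [c2E|[c2E|[c2E|c2E]]] : c2 = -2 \/ c2 = -1 \/ c2 = 0 \/ c2 = 1 by nia.
- case: nr2; rewrite rootE -polyC1.
  rewrite !(hornerD, hornerN, hornerZ, hornerXn, hornerX, hornerC).
  move: Pa; rewrite c0E c1E c2E => Pa.
  apply/eqP; apply: etrans Pa; ring.
- by move: P0; rewrite c0E c2E.
- case: nr1; rewrite rootE -polyC1.
  rewrite !(hornerD, hornerN, hornerZ, hornerXn, hornerX, hornerC).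
  move: Pa; rewrite c0E c1E c2E => Pa.
  apply/eqP; apply: etrans Pa; ring.
- have a2 : 2 < a by move: c0a; rewrite c0E c2E.
  by move: Pa; rewrite c0E c1E c2E; nra.
Qed.

(** Besides [a] there is a real root [r] with 0 < -a r < 1. The four roots have product -1, so the
    other two have product above 1 and cannot both lie in the disc. *)
Lemma quartic_not_dominant : map_poly intr P != 'X^4 - 'X - 1 :> {poly R}.
Proof.
apply/eqP => P4.
have Px (x : R) : x ^+ 4 - x - 1 = (x - a) * Q.[x].
  by have := congr1 (horner^~ x) PQ; rewrite P4 !hornerE.
have Q1 : Q.[1] >= 0 by rewrite ltW // roots_in_disc_gt0.
have sQ : size Q = 4%N.
  have := congr1 (fun p : {poly R} => size p) PQ.
  rewrite size_monicM ?monicXsubC ?monic_neq0 // size_XsubC /= P4.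
  rewrite -addrA size_polyDl ?size_polyXn; first by case.
  by rewrite -opprD size_polyN size_polyDl ?size_polyX ?size_poly1.
have QN1 : Q.[-1] <= 0.
  have := roots_in_disc_sign Qdisc Qmon (lexx (-1)).
  by rewrite sQ -signr_odd /= expr1 mulN1r oppr_gt0 => /ltW.
have [r _ Qr] : exists2 r : R, -1 <= r <= 1 & root Q r.
  by apply: poly_ivt; [lra | rewrite QN1 Q1].
have := roots_in_disc_real Qdisc Qr; rewrite ltr_norml => /andP[rN1 r1].
have Pr : r ^+ 4 - r - 1 = 0 by rewrite Px (rootP Qr) mulr0.
have [Q2 Q2E] := factor_theorem _ _ Qr.
have Q2mon : Q2 \is monic by rewrite -(monicMr _ (monicXsubC r)) -Q2E.
have Q2disc : roots_in_disc Q2.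
  by move=> z Q2z; apply: Qdisc; rewrite Q2E rmorphM /= rootM Q2z.
have sQ2 : (1 < size Q2)%N.
  move: sQ; rewrite Q2E size_Mmonic ?monicXsubC ?monic_neq0 //.
  by rewrite size_XsubC addn2 /= => -[->].
have := roots_in_disc_const Q2disc Q2mon sQ2; rewrite ltr_norml => /andP[t1 t2].
have := Px 0; rewrite Q2E hornerM hornerXsubC => Pt.
have Pa : a ^+ 4 - a - 1 = 0 by rewrite Px subrr mul0r.
clear P4 Q2E.
(* The bounds 1.23 on [a] and 0.8 on [-r] suffice, as their product is 0.984. *)
have a_le : a <= 123 / 100.
  rewrite leNgt; apply/negP => a_gt.
  have a2 : 151 / 100 < a ^+ 2 by nra.
  have a3 : 185 / 100 < a ^+ 3 by rewrite exprS; nra.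
  by move: Pa; rewrite exprS; nra.
have r_gt : - (8 / 10) < r.
  rewrite ltNge; apply/negP => r_le.
  have r2 : 64 / 100 <= r ^+ 2 by nra.
  have r4 : 4 / 10 <= r ^+ 4 by rewrite (exprM r 2 2) expr2; nra.
  by lra.
have r_lt : r < 0.
  rewrite ltNge; apply/negP => r_ge.
  have r4 : r ^+ 4 < 1 by rewrite exprn_ilt1.
  by lra.
have ar : 0 < a * - r < 1 by apply/andP; split; nra.
have art : (a * - r) * Q2.[0] = 1 by move: Pt; rewrite expr0n /=; lra.
by move: ar => /andP[]; nra.
Qed.

Lemma third_le_degree4 : size P = 5%N -> P`_0 != 0 ->
  ~~ root ('X^4 - 'X^3 - 1 : {poly R}) a -> 1 / 3 <= pisot_L a.
Proof.
move=> sP P0 /negP nr; have [//|] := third_le_or_units.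
have := dominant_root_horner0; rewrite sP => /(_ isT).
have := dominant_root_eq0; rewrite (horner_monic_intr _ Pmon sP).
rewrite !(horner_monic_int _ Pmon sP) !big_ord_recr !big_ord0 /=.
rewrite add0r expr0 mulr1 expr1.
move: P0; set c0 := P`_0; set c1 := P`_1; set c2 := P`_2; set c3 := P`_3.
move=> P0 Pa c0a [P1 PN1].
have c1E : c1 = -1 - c3 by lia.
have c2E : c2 = -1 - c0 by lia.
pose A := 2 * c0 + 2; pose B := -1 - 2 * c3.
have Pi : (map_poly intr P).['i%C] = (A%:~R +i* B%:~R)%C :> R[i].
  rewrite (horner_monic_intr _ Pmon sP) !big_ord_recr !big_ord0 /=.
  rewrite -/c0 -/c1 -/c2 -/c3 c1E c2E -!(rmorph_int (real_complex R)).
  rewrite !exprS expr0 /A /B.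
  by apply/eqP; rewrite eq_complex /=; apply/andP; split; apply/eqP;
    rewrite ?(rmorphB, rmorphD, rmorphM, rmorphN) /=; ring.
have [N|N] := leP (3 * (`|A| + `|B|)) (A ^+ 2 + B ^+ 2).
  apply: (pisot_L_ge_third_imaginary dom Pi) => //.
  (* [B] is odd, hence nonzero. *)
  by rewrite ltr_wpDl ?sqr_ge0 // exprn_even_gt0 //= /B; lia.
(* Completing the square in |y| gives x^2 - 3|x| < 9/4, which fails for |x| >= 4. *)
have bound (x y : int) : x ^+ 2 + y ^+ 2 < 3 * (`|x| + `|y|) -> `|x| <= 3.
  rewrite -(real_normK (num_real x)) -(real_normK (num_real y)) => xy.
  have y0 := sqr_ge0 (2 * `|y| - 3).
  rewrite leNgt; apply/negP => x3.
  have x0 : 0 <= (`|x| - 4) * `|x| by rewrite mulr_ge0 //; lia.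
  by lia.
have A3 : `|A| <= 3 := bound _ _ N.
have B3 : `|B| <= 3 by apply: (bound _ A); rewrite addrC [X in 3 * X]addrC.
(* [A] is even, so |A| <= 3 leaves c0 in {-2, -1, 0}, and 0 is ruled out by [P0]. *)
have [c0E|c0E] : c0 = -1 \/ c0 = -2 by lia.
  have [c3E|c3E] : c3 = -1 \/ c3 = 0 by nia.
    case: nr; rewrite rootE -polyC1.
    rewrite !(hornerD, hornerN, hornerXn, hornerC).
    move: Pa; rewrite c1E c2E c0E c3E => Pa.
    by apply/eqP; apply: etrans Pa; ring.
  have := quartic_not_dominant; case/eqP.
  apply/polyP => i; rewrite coef_map !coefB coefXn coefX coef1 /=.
  case: i => [|[|[|[|[|i]]]]].
  - by rewrite -/c0 c0E /=; ring.
  - by rewrite -/c1 c1E c3E /=; ring.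
  - by rewrite -/c2 c2E c0E /=; ring.
  - by rewrite -/c3 c3E /=; ring.
  - by have := monicP Pmon; rewrite lead_coefE sP /= => -> /=; ring.
  - by rewrite nth_default ?sP //=; ring.
(* The four quartics left with c0 = -2 are all positive beyond 2. *)
have a2 : 2 < a by move: c0a; rewrite c0E.
have [c3E|[c3E|[c3E|c3E]]] : c3 = -2 \/ c3 = -1 \/ c3 = 0 \/ c3 = 1 by lia.
- by move: Pa; rewrite c1E c2E c0E c3E; nra.
- by move: Pa; rewrite c1E c2E c0E c3E; nra.
- by move: Pa; rewrite c1E c2E c0E c3E; nra.
- by move: Pa; rewrite c1E c2E c0E c3E; nra.
Qed.

End SmallDegree.

Theorem theorem4 (R : realType) (alpha : R) (d : nat)
  (alpha_pisot : pisot alpha)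
  (alpha_degree : has_degree alpha d)
  (d_le4 : (d <= 4)%N)
  (not_root1 : ~~ root ('X^2 - 'X - 1 : {poly R}) alpha)
  (not_root2 : ~~ root ('X^3 - 'X - 1 : {poly R}) alpha)
  (not_root3 : ~~ root ('X^4 - 'X^3 - 1 : {poly R}) alpha)
  (not_root4 : ~~ root ('X^3 - 2%:R *: 'X^2 - 'X + 1 : {poly R}) alpha) :
  1 / 3 <= pisot_L alpha.
Proof.
have alpha1 : 1 < alpha by case: alpha_pisot.
have [P [Q [dom sP Pirr]]] := pisot_dominant_root alpha_pisot alpha_degree.
have sPQ : size (map_poly intr P : {poly rat}) = d.+1.
  by rewrite -sP size_map_inj_poly //; exact: intr_inj.
(* Degree 1 is left out because ['X] itself is irreducible. *)
have P0 : (1 < d)%N -> P`_0 != 0.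
  move=> d1; have := irreducible_horner0 Pirr; rewrite sPQ => /(_ d1).
  by rewrite horner_coef0 coef_map intr_eq0.
case: d d_le4 P0 sP sPQ {alpha_degree} => [|[|[|[|[|]]]]] // _ P0 sP sPQ.
- by case: Pirr; rewrite sPQ.
- exact: third_le_degree1 dom sP.
- exact: third_le_degree2 dom sP not_root1.
- exact: third_le_degree3 dom sP (P0 isT) not_root2 not_root4.
- exact: third_le_degree4 dom sP (P0 isT) not_root3.
Qed.
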